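(* Let $n\geq 1$ be an integer. For any random vector $X$ with values in $\mathbb{R}^n$, any nonempty set $T\subseteq\mathbb{R}^n$ and any real $p\geq 2$, $$\left(\mathbb{E}\sup_{t\in T}|\langle t,X\rangle|^p\right)^{1/p}\leq 2\sqrt{e}\,\sqrt{\frac{n+p}{p}}\;\sup_{t\in T}\left(\mathbb{E}|\langle t,X\rangle|^p\right)^{1/p}.$$ In particular, for any norm $\|\cdot\|$ on $\mathbb{R}^n$ with dual norm $\|\cdot\|_*$, any random vector $X$ with values in $\mathbb{R}^n$ and any real $p\geq 2$, $$\left(\mathbb{E}\|X\|^p\right)^{1/p}\leq 2\sqrt{e}\,\sqrt{\frac{n+p}{p}}\;\sup_{\|t\|_*\leq 1}\left(\mathbb{E}|\langle t,X\rangle|^p\right)^{1/p}.$$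
   Context: $\langle\cdot,\cdot\rangle$ is the standard inner product on $\mathbb{R}^n$. The dual norm is $\|t\|_*=\sup\{|\langle t,x\rangle| : \|x\|\leq 1\}$. Moments may take the value $+\infty$, and the inequalities are understood in $[0,\infty]$. *)

(* Defs.v *)
From HB Require Import structures.
From mathcomp Require Import all_boot all_order all_algebra.
From mathcomp Require Import all_classical all_reals all_analysis.

Set Implicit Arguments.
Unset Strict Implicit.
Unset Printing Implicit Defensive.

Import Order.TTheory GRing.Theory Num.Theory.
Import numFieldNormedType.Exports.

Local Open Scope classical_set_scope.
Local Open Scope ring_scope.

(* R^n with its Borel sigma-algebra; [{RV P >-> borel_rV R n}] is the type of
   random vectors with values in R^n. *)
Notation borel_rV R n := (g_sigma_algebraType (@open 'rV[R]_n)).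

Definition dotp (R : realType) (n : nat) (t x : 'rV[R]_n) : R :=
  \sum_(i < n) t ord0 i * x ord0 i.

(* Nonnegativity is not listed because it follows from the other axioms. *)
Record is_norm (R : realType) (n : nat) (N : 'rV[R]_n -> R) : Prop := IsNorm {
  is_norm_triangle : forall x y, N (x + y) <= N x + N y ;
  is_norm_homogeneous : forall (a : R) x, N (a *: x) = `|a| * N x ;
  is_norm_definite : forall x, N x = 0 -> x = 0
}.

(* The supremum is taken in \bar R, where it always exists; for a norm N on R^n
   its value is a nonnegative real. *)
Definition dual_norm (R : realType) (n : nat) (N : 'rV[R]_n -> R)
    (t : 'rV[R]_n) : \bar R :=
  ereal_sup [set (`|dotp t x|)%:E | x in [set x : 'rV[R]_n | N x <= 1]].

(* Main.v *)
Require Import Defs.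
From HB Require Import structures.
From mathcomp Require Import all_boot all_order all_algebra.
From mathcomp Require Import all_classical all_reals all_analysis.
From mathcomp Require Import measurable_realfun.
From mathcomp Require Import ring lra.

Set Implicit Arguments.
Unset Strict Implicit.
Unset Printing Implicit Defensive.

Import Order.TTheory GRing.Theory Num.Theory.
Import numFieldNormedType.Exports.

Local Open Scope classical_set_scope.
Local Open Scope ring_scope.

(** Let [k] be the integer part of [p / 2], so that [2 k <= p <= 4 k], and let
    [N = 'C(n + k - 1, k)] be the dimension of the homogeneous polynomials of
    degree [k] in [n] variables.

    If [p = 2 k], the theorem comes from the L^2 estimate
    [E sup_t f_t^2 <= N * sup_t E f_t^2], valid for any family of functions
    [f_t] in a space of dimension at most [N], applied to [f_t = <t,X>^k]. For
    an orthonormal basis [e_j] of that space and [H = sum_j e_j^2], the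
    Cauchy-Schwarz inequality gives [f_t^2 <= (E f_t^2) * H], and [E H <= N]
    ([gram_schmidt], [christoffel_bound], [separable_ae_bound]). That the powers
    [<t,x>^k] live in dimension [N] is [separable_exp_sum]. As [T] is arbitrary,
    only the [<t,X>] with [t] in [T] are known to have moments, so the basis is
    extracted from the [f_t] themselves ([separable_selection]).

    For a general [p], put [q = 2 k / p <= 1], and let [h] be a simple function
    below [sup_t |<t,X>|^p]. Applied to [f_t = <t,X>^k * h^((1 - q) / 2)], the
    previous estimate gives [E h <= N * sup_t E (|<t,X>|^(2 k) * h^(1 - q))],
    and by Hoelder's inequality this is at most [N * A^q * (E h)^(1 - q)], where [A]
    bounds the weak moments [E |<t,X>|^p]. As [E h] is finite, it follows that
    [E h <= N^(1 / q) * A] ([nnsfun_strong_moment]), and the supremum over [h] is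
    the desired integral. Finally
    [N <= (e * (n + k - 1) / k)^k <= (4 * e * (n + p) / p)^k]
    ([bin_le_moment_constant]).

    The statement on norms is the case where [T] is the dual unit ball: by the
    Hahn-Banach theorem, every [x] has some [t] in that ball with
    [N(x) <= <t,x>] ([norm_attained_dual_ball]). *)

(** * Separable kernels *)

(** A kernel [F] on [U * V] is separable of rank at most [N] when it is a sum
    of [N] products of a function of the first variable by a function of the
    second one. The factors are indexed by [nat], only the indices below [N]
    being relevant. *)
Definition separable (R : pzRingType) (U V : Type) (N : nat)
    (F : U -> V -> R) : Prop :=
  exists a : nat -> U -> R, exists b : nat -> V -> R,
    forall u v, F u v = \sum_(j < N) a j u * b j v.

Lemma separableD (R : pzRingType) (U V : Type) (M N : nat)
    (F G : U -> V -> R) :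
  separable M F -> separable N G ->
  separable (M + N) (fun u v => F u v + G u v).
Proof.
move=> [a [b FE]] [a' [b' GE]].
exists (fun j => if (j < M)%N then a j else a' (j - M)%N).
exists (fun j => if (j < M)%N then b j else b' (j - M)%N) => u v.
rewrite big_split_ord /= FE GE; congr (_ + _); apply: eq_bigr => j _ /=.
  by rewrite ltn_ord.
by rewrite ltnNge leq_addr /= addKn.
Qed.

Lemma separable_sum (R : pzRingType) (U V : Type) (m : nat) (N : nat -> nat)
    (F : nat -> U -> V -> R) :
  (forall i, separable (N i) (F i)) ->
  separable (\sum_(i < m) N i) (fun u v => \sum_(i < m) F i u v).
Proof.
move=> sF; elim: m => [|m IHm].
  by exists (fun _ _ => 0), (fun _ _ => 0) => u v; rewrite !big_ord0.
rewrite big_ord_recr /=.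
have [a [b E]] := separableD IHm (sF m).
by exists a, b => u v; rewrite big_ord_recr /= E.
Qed.

Lemma separableM (R : comPzRingType) (U V : Type) (N : nat)
    (f : U -> R) (g : V -> R) (F : U -> V -> R) :
  separable N F -> separable N (fun u v => F u v * (f u * g v)).
Proof.
move=> [a [b FE]]; exists (fun j u => a j u * f u), (fun j v => b j v * g v).
by move=> u v; rewrite FE mulr_suml; apply: eq_bigr => j _; ring.
Qed.

Lemma hockey_stick (m k : nat) :
  (\sum_(i < k.+1) 'C(m + (k - i), k - i) = 'C(m.+1 + k, k))%N.
Proof.
elim: k => [|k IHk]; first by rewrite big_ord1 subn0 !bin0.
rewrite big_ord_recl subn0 /=.
under eq_bigr => i _ do rewrite /bump /= add1n subSS.
by rewrite IHk !addnS binS addSn.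
Qed.

(** The [k]-th power of the inner product is separable, of rank at most the
    dimension of the homogeneous polynomials of degree [k] in [size s] variables. The
    truncated subtraction gives the right value for [s] empty as well: rank 1
    if [k = 0], rank 0 otherwise. *)
Lemma separable_exp_sum (R : comPzRingType) (I : Type) (s : seq I) (k : nat) :
  separable 'C(size s + k - 1, k)
    (fun x y : I -> R => (\sum_(i <- s) x i * y i) ^+ k).
Proof.
elim: s k => [|i s IHs] k.
  case: k => [|k].
    exists (fun _ _ => 1), (fun _ _ => 1) => u v.
    by rewrite big_ord1 expr0 mulr1.
  rewrite bin_small; last by rewrite /= add0n subn1.
  by exists (fun _ _ => 0), (fun _ _ => 0) => u v; rewrite big_nil big_ord0 exprS mul0r.
rewrite [size _]/= addSn subn1 /=.
(* With a single variable the predecessor of [size s] below would truncate. *)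
have [s0|s_gt0] := posnP (size s).
  move/size0nil: s0 => ->; rewrite add0n binn.
  exists (fun _ u => u i ^+ k), (fun _ v => v i ^+ k) => u v.
  by rewrite big_ord1 big_seq1 exprMn.
(* Binomial expansion with respect to the first variable. *)
have := @separable_sum _ (I -> R) (I -> R) k.+1
  (fun j => 'C(size s + (k - j) - 1, k - j)) 
  (fun j u v => (\sum_(i <- s) u i * v i) ^+ (k - j) *
     ((u i ^+ j * 'C(k, j)%:R) * v i ^+ j)).
rewrite (eq_bigr (fun j : 'I_k.+1 => 'C((size s).-1 + (k - j), k - j))); last first.
  by move=> j _; rewrite -addnBAC// subn1.
rewrite hockey_stick prednK// => H.
have [|a [b E]] := H; first by move=> j; apply/separableM/IHs.
exists a, b => u v; rewrite -E big_cons addrC exprDn.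
by apply: eq_bigr => j _; rewrite exprMn mulrnAr -mulr_natr; ring.
Qed.

(** All the sections [F u], for [u] in [T], are combinations of at most [N] of
    them, the identity holding at every point. The default value of [nth] is
    irrelevant since the indices are in range. *)
Lemma separable_selection (R : fieldType) (U V : Type) (N : nat)
    (F : U -> V -> R) (T : set U) :
  separable N F ->
  exists ts : seq U, [/\ (size ts <= N)%N,
    forall i u0, (i < size ts)%N -> T (nth u0 ts i) &
    forall u, T u -> exists c : nat -> R, forall v,
      F u v = \sum_(i < size ts) c i * F (nth u ts i) v].
Proof.
move=> [a [b FE]].
pose s u : 'rV[R]_N := \row_j a j u.
(* A list of elements of [T] is good when their coefficient vectors are linearly
   independent; the generators are a good list of maximal size. *)
pose good ts := free [seq s u | u <- ts] /\
  (forall i u0, (i < size ts)%N -> T (nth u0 ts i)).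
pose P m := `[< exists ts, good ts /\ size ts = m >].
have good_size ts : good ts -> (size ts <= N)%N.
  move=> [/eqP fts _]; rewrite -(size_map s) -fts.
  by rewrite (leq_trans (dimvS (subvf _)))// dimvf /dim /= mul1n.
have exP : exists m, P m.
  by exists 0%N; apply/asboolP; exists [::]; split => //; split => //; apply: nil_free.
have bndP m : P m -> (m <= N)%N.
  by move=> /asboolP [ts [gts <-]]; apply: good_size.
case: (ex_maxnP exP bndP) => m /asboolP [ts [gts sts]] mmax.
exists ts; split; [exact: good_size|by case: gts|move=> u Tu].
have su : s u \in <<[seq s u | u <- ts]>>%VS.
  apply/negPn/negP => su.
  have /mmax : P m.+1.
    apply/asboolP; exists (u :: ts); split; last by rewrite /= sts.
    split; first by rewrite /= free_cons su; case: gts.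
    by case=> [|i] u0 //= il; case: gts => _; apply.
  by rewrite ltnn.
pose c (i : nat) : R :=
  if insub i is Some i' then coord (map_tuple s (in_tuple ts)) i' (s u) else 0.
exists c => v; rewrite FE.
have sE := coord_span (X := map_tuple s (in_tuple ts)) su.
under eq_bigr => j _.
  have -> : a j u = s u ord0 j by rewrite mxE.
  rewrite {1}sE summxE mulr_suml.
  over.
rewrite exchange_big /=; apply: eq_bigr => i _.
rewrite FE mulr_sumr; apply: eq_bigr => j _.
rewrite mxE (nth_map u) ?ltn_ord// mxE mulrA; congr (_ * _ * _).
rewrite /c; case: insubP => [i2 _ i2E|]; last by rewrite ltn_ord.
by congr (coord _ _ _); apply: val_inj.
Qed.

(** * Orthonormal families and Christoffel functions *)

Lemma cauchy_schwarz_sum (R : realFieldType) (m : nat) (x y : nat -> R) :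
  (\sum_(i < m) x i * y i) ^+ 2
    <= (\sum_(i < m) x i ^+ 2) * (\sum_(i < m) y i ^+ 2).
Proof.
have expand a b : \sum_(i < m) (a * y i - b * x i) ^+ 2 =
    a ^+ 2 * (\sum_(i < m) y i ^+ 2) - (2 * a * b) * (\sum_(i < m) x i * y i)
    + b ^+ 2 * (\sum_(i < m) x i ^+ 2).
  rewrite !mulr_sumr -sumrN -!big_split /=.
  by apply: eq_bigr => i _; ring.
set D := \sum_(i < m) x i ^+ 2; set E := \sum_(i < m) y i ^+ 2.
set S := \sum_(i < m) x i * y i.
have D0 : 0 <= D by apply: sumr_ge0 => i _; exact: sqr_ge0.
have : 0 <= \sum_(i < m) (D * y i - S * x i) ^+ 2.
  by apply: sumr_ge0 => i _; exact: sqr_ge0.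
rewrite expand -/D -/E -/S.
have [D00 _|D_gt0] := eqVneq D 0.
  suff -> : S = 0 by rewrite expr0n /= D00 mul0r.
  apply: big1 => i _; apply/eqP; rewrite mulf_eq0; apply/orP; left.
  rewrite -sqrf_eq0; apply/eqP.
  exact: (psumr_eq0P (fun j _ => sqr_ge0 (x (nat_of_ord j))) D00).
have {}D0 : 0 < D by rewrite lt0r D_gt0.
rewrite (_ : _ + _ = D * (D * E - S ^+ 2)); last by ring.
by rewrite pmulr_rge0// subr_ge0.
Qed.

(** The inner product of L^2 as a real number; it is meaningful for two square
    integrable functions. *)
Definition ip {d} {T : measurableType d} {R : realType}
  (mu : {measure set T -> \bar R}) (f g : T -> R) : R :=
  (\int[mu]_x (f x * g x))%R.

Section inner_product.
Context d (T : measurableType d) (R : realType).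
Variable mu : {measure set T -> \bar R}.
Local Notation L2 := (Lfun mu 2%:E).
Implicit Types (f g h : T -> R).

Lemma L2_measurable f : f \in L2 -> measurable_fun setT f.
Proof. by rewrite inE => /andP[/[!inE]]. Qed.

Lemma L2_lin a f g : f \in L2 -> g \in L2 -> (fun x => a * f x + g x) \in L2.
Proof.
have [_ H] := @Lfun_submod_closed _ T R mu 2%:E (lee1n 2).
exact: H.
Qed.

Lemma L2_0 : (fun=> 0 : R) \in L2.
Proof. by have [H _] := @Lfun_submod_closed _ T R mu 2%:E (lee1n 2). Qed.

Lemma L2_sum m (c : nat -> R) (f : nat -> T -> R) :
  (forall i, (i < m)%N -> f i \in L2) ->
  (fun x => \sum_(i < m) c i * f i x) \in L2.
Proof.
elim: m => [|m IHm] fL2.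
  by under eq_fun do rewrite big_ord0; exact: L2_0.
under eq_fun do rewrite big_ord_recr /= addrC.
by apply: L2_lin; [exact: fL2|apply: IHm => i im; apply: fL2; exact: ltnW].
Qed.

Lemma L2_mul_integrable f g : f \in L2 -> g \in L2 ->
  mu.-integrable setT (EFin \o (fun x => f x * g x)).
Proof. by move=> fL gL; apply/Lfun1_integrable; exact: Lfun2_mul_Lfun1. Qed.

Lemma EFin_ip f g : f \in L2 -> g \in L2 ->
  (ip mu f g)%:E = (\int[mu]_x (f x * g x)%:E)%E.
Proof.
move=> fL gL; rewrite /ip /Rintegral fineK//.
by have := L2_mul_integrable fL gL; exact: integrable_fin_num.
Qed.

Lemma ipC f g : ip mu f g = ip mu g f.
Proof. by apply: eq_Rintegral => x _; rewrite mulrC. Qed.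

Lemma ip_lin a f g h : f \in L2 -> g \in L2 -> h \in L2 ->
  ip mu (fun x => a * f x + g x) h = a * ip mu f h + ip mu g h.
Proof.
move=> fL gL hL; rewrite /ip -RintegralZl//; last exact: L2_mul_integrable.
rewrite -RintegralD//.
- by apply: eq_Rintegral => x _; ring.
- have /L2_mul_integrable H := L2_lin a fL L2_0.
  move: (H _ hL); apply: eq_integrable => // x _ /=.
  by rewrite addr0 mulrA.
- exact: L2_mul_integrable.
Qed.

Lemma ip_suml m (c : nat -> R) (f : nat -> T -> R) h :
  (forall i, (i < m)%N -> f i \in L2) -> h \in L2 ->
  ip mu (fun x => \sum_(i < m) c i * f i x) h = \sum_(i < m) c i * ip mu (f i) h.
Proof.
elim: m => [|m IHm] fL2 hL2.
  rewrite big_ord0 /ip; under eq_Rintegral do rewrite big_ord0 mul0r.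
  by rewrite Rintegral_cst// mul0r.
have fL i : (i < m)%N -> f i \in L2 by move=> im; apply: fL2; exact: ltnW.
rewrite big_ord_recr /= -(IHm fL hL2) addrC -ip_lin//; last 2 first.
- exact: fL2.
- exact: L2_sum.
by apply: eq_Rintegral => x _; rewrite big_ord_recr /= addrC.
Qed.

Lemma ip_ae_eq f g f' g' : f \in L2 -> g \in L2 -> f' \in L2 -> g' \in L2 ->
  {ae mu, forall x, f x = f' x} -> {ae mu, forall x, g x = g' x} ->
  ip mu f g = ip mu f' g'.
Proof.
move=> fL gL fL' gL' ff' gg'; congr fine; apply: ae_eq_integral => //.
- exact: measurable_int (L2_mul_integrable fL gL).
- exact: measurable_int (L2_mul_integrable fL' gL').
by move: ff' gg'; apply: filterS2 => x fx gx _; rewrite /= fx gx.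
Qed.

Lemma ip_eq0 f : f \in L2 -> ip mu f f = 0 -> {ae mu, forall x, f x = 0}.
Proof.
move=> fL f0; have ffint := L2_mul_integrable fL fL.
have mff := measurable_int _ ffint.
have : (\int[mu]_x `|(EFin \o (fun x => (f x * f x)%R)) x| = 0)%E.
  under eq_integral => x _ do rewrite /= ger0_norm -?expr2 ?sqr_ge0//.
  by rewrite -[RHS]/(0%R%:E) -f0 EFin_ip.
move/(ae_eq_integral_abs mu measurableT mff) => H.
move: (H); apply: filterS => x /(_ I) /= [fx0]; move/eqP: fx0.
by rewrite mulf_eq0 orbb => /eqP.
Qed.

(** Orthonormalization. Degenerate families are allowed: a function that is
    almost everywhere a combination of the previous ones adds no vector, so
    [r] may be less than [m]. *)
Lemma gram_schmidt (f : nat -> T -> R) (m : nat) :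
  (forall i, (i < m)%N -> f i \in L2) ->
  exists r (e : nat -> T -> R), [/\ (r <= m)%N,
    forall i, (i < r)%N -> e i \in L2,
    forall i j, (i < r)%N -> (j < r)%N -> ip mu (e i) (e j) = (i == j)%:R &
    exists A : nat -> nat -> R, forall i, (i < m)%N ->
      {ae mu, forall x, f i x = \sum_(j < r) A i j * e j x}].
Proof.
elim: m => [|m IHm] fL2.
  by exists 0%N, (fun _ _ => 0); split => //; exists (fun _ _ => 0).
have [i im|r [e [rm eL2 eon [A fE]]]] := IHm.
  by apply: fL2; exact: ltnW.
(* [g] is the component of [f m] orthogonal to the vectors already built. *)
pose c j := ip mu (f m) (e j).
pose g x := f m x - \sum_(j < r) c j * e j x.
have sL2 : (fun x => \sum_(j < r) c j * e j x) \in L2 by exact: L2_sum.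
have gE : g = (fun x => (-1) * (\sum_(j < r) c j * e j x) + f m x).
  by apply/funext => x; rewrite /g; ring.
have gL2 : g \in L2 by rewrite gE; apply: L2_lin => //; exact: fL2.
have g_orth j : (j < r)%N -> ip mu g (e j) = 0.
  move=> jr; rewrite gE ip_lin//; [|exact: fL2|exact: eL2].
  rewrite ip_suml//; last exact: eL2.
  rewrite (bigD1 (Ordinal jr))//= eon// eqxx mulr1 big1.
    by rewrite addr0 mulN1r addNr.
  move=> i ij; rewrite eon// (_ : (_ == _) = false) ?mulr0//.
  by apply/negP => /eqP ij'; move/eqP: ij; apply; apply: val_inj.
have [g0|g0] := eqVneq (ip mu g g) 0.
  exists r, e; split => //; first exact: leqW.
  exists (fun i j => if i == m then c j else A i j) => i.
  rewrite ltnS leq_eqVlt => /predU1P[->|im].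
    rewrite eqxx; have H := ip_eq0 gL2 g0.
    by move: (H); apply: filterS => x /eqP; rewrite /g subr_eq0 => /eqP.
  by rewrite (ltn_eqF im); exact: fE.
have {}g0 : 0 < ip mu g g.
  rewrite lt0r g0 /=; apply: Rintegral_ge0 => x _.
  by rewrite -expr2 sqr_ge0.
pose s := Num.sqrt (ip mu g g).
have s0 : 0 < s by rewrite sqrtr_gt0.
have ss : s * s = ip mu g g by rewrite -expr2 sqr_sqrtr ?ltW.
(* The summand 0 puts the scaled function in the form of [L2_lin]. *)
pose e' j := if j == r then (fun x => s^-1 * g x + 0) else e j.
have hL2 : (fun x => s^-1 * g x + 0) \in L2 by apply: L2_lin => //; exact: L2_0.
have ip0 h : ip mu (fun=> 0) h = 0.
  by rewrite /ip; under eq_Rintegral do rewrite mul0r; rewrite Rintegral_cst ?mul0r.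
have e'L2 i : (i < r.+1)%N -> e' i \in L2.
  by rewrite ltnS leq_eqVlt /e' => /predU1P[->|ir]; rewrite ?eqxx ?(ltn_eqF ir) ?eL2.
exists r.+1, e'; split => //.
- move=> i j; rewrite (ltnS i) (ltnS j) (leq_eqVlt i) (leq_eqVlt j) /e'.
  move=> /predU1P[->|ir] /predU1P[->|jr].
  + rewrite !eqxx ip_lin//; last exact: L2_0.
    rewrite ip0 addr0 ipC ip_lin//; last exact: L2_0.
    by rewrite ip0 addr0 -ss mulr1n mulKf ?mulVf ?gt_eqF.
  + rewrite eqxx (ltn_eqF jr) (gtn_eqF jr) ip_lin//; [|exact: L2_0|exact: eL2].
    by rewrite ip0 g_orth// mulr0 addr0.
  + rewrite eqxx (ltn_eqF ir) ipC ip_lin//; [|exact: L2_0|exact: eL2].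
    by rewrite ip0 g_orth// mulr0 addr0.
  + by rewrite (ltn_eqF ir) (ltn_eqF jr) eon.
- exists (fun i j => if i == m then (if j == r then s else c j)
                     else (if j == r then 0 else A i j)) => i.
  rewrite ltnS leq_eqVlt => /predU1P[->|im].
    apply: aeW => x; rewrite eqxx big_ord_recr /= /e' eqxx addr0.
    rewrite mulrA mulfV ?gt_eqF// mul1r.
    rewrite (eq_bigr (fun j : 'I_r => c j * e j x)); last first.
      by move=> j _; rewrite (ltn_eqF (ltn_ord j)).
    by rewrite /g addrC subrK.
  rewrite (ltn_eqF im); move: (fE i im); apply: filterS => x ->.
  rewrite big_ord_recr /= /e' eqxx mul0r addr0; apply: eq_bigr => j _.
  by rewrite (ltn_eqF (ltn_ord j)).
Qed.

(** The Christoffel function [H] of the span of [m] functions, that is the sum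
    of the squares of an orthonormal basis: it bounds the square of every
    normalized element of the span, outside a single null set, and its
    integral is at most [m]. *)
Lemma christoffel_bound (f : nat -> T -> R) (m : nat) :
  (forall i, (i < m)%N -> f i \in L2) ->
  exists H : T -> R, [/\ forall x, 0 <= H x, measurable_fun setT H,
    (\int[mu]_x (H x)%:E <= m%:R%:E)%E &
    {ae mu, forall x, forall c : nat -> R,
      (\sum_(i < m) c i * f i x) ^+ 2 <=
      ip mu (fun y => \sum_(i < m) c i * f i y)
            (fun y => \sum_(i < m) c i * f i y) * H x}].
Proof.
move=> fL2; have [r [e [rm eL2 eon [A fE]]]] := gram_schmidt fL2.
have mH : measurable_fun setT (fun x => \sum_(j < r) e j x ^+ 2).
  apply: measurable_sum => j; apply: measurable_funX.
  exact/L2_measurable/eL2.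
exists (fun x => \sum_(j < r) e j x ^+ 2); split => //.
- by move=> x; apply: sumr_ge0 => j _; exact: sqr_ge0.
- under eq_integral => x _ do rewrite -sumEFin.
  rewrite integral_sum//; last first.
    move=> j; have := L2_mul_integrable (eL2 j (ltn_ord j)) (eL2 j (ltn_ord j)).
    by apply: eq_integrable => // x _ /=; rewrite expr2.
  rewrite (eq_bigr (fun=> 1%E)); last first.
    move=> j _; rewrite -[RHS]/((true : nat)%:R%:E) -(eqxx (j : nat)) -eon//.
    rewrite EFin_ip ?eL2//; by apply: eq_integral => x _; rewrite expr2.
  by rewrite sumEFin sumr_const card_ord lee_fin ler_nat.
have /ae_foralln H : forall i, {ae mu, forall x, (i < m)%N ->
    f i x = \sum_(j < r) A i j * e j x}.
  move=> i; have [im|im] := boolP (i < m)%N; last exact: aeW.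
  by move: (fE i im); apply: filterS => x ->.
have lcE x (c : nat -> R) :
    (forall i, (i < m)%N -> f i x = \sum_(j < r) A i j * e j x) ->
    \sum_(i < m) c i * f i x =
    \sum_(j < r) (\sum_(i < m) c i * A i j) * e j x.
  move=> fx; under eq_bigr => i _ do rewrite fx// mulr_sumr.
  rewrite exchange_big /=; apply: eq_bigr => j _; rewrite mulr_suml.
  by apply: eq_bigr => i _; rewrite mulrA.
move: (H); apply: filterS => x fx c.
pose a j := \sum_(i < m) c i * A i j.
rewrite (_ : ip mu _ _ = \sum_(j < r) a j ^+ 2); last first.
  have aL2 : (fun y => \sum_(j < r) a j * e j y) \in L2 by exact: L2_sum.
  have fcL2 : (fun y => \sum_(i < m) c i * f i y) \in L2 by exact: L2_sum.
  rewrite (ip_ae_eq fcL2 fcL2 aL2 aL2); last 2 first.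
  - by move: (H); apply: filterS => y fy; exact: lcE.
  - by move: (H); apply: filterS => y fy; exact: lcE.
  rewrite ip_suml//; apply: eq_bigr => j _; rewrite expr2; congr (_ * _).
  rewrite ipC ip_suml//; last exact: eL2.
  rewrite (bigD1 j)//= eon// eqxx mulr1 big1 ?addr0// => i ij.
  rewrite eon// (_ : (_ == _) = false) ?mulr0//.
  by apply/negP => /eqP ij'; move/eqP: ij; apply; apply: val_inj.
by rewrite lcE//; exact: (cauchy_schwarz_sum r a (fun j => e j x)).
Qed.

End inner_product.

(** For an arbitrary family of functions that is separable of rank [N] and
    bounded in L^2, the squares have a common integrable majorant, outside a
    null set that does not depend on the member of the family. *)
Lemma separable_ae_bound d (Om : measurableType d) (R : realType)
    (mu : {measure set Om -> \bar R}) (U : Type) (S : set U)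
    (F : U -> Om -> R) (N : nat) (C : R) :
  separable N F ->
  (forall u, S u -> F u \in Lfun mu 2%:E) ->
  (forall u, S u -> ip mu (F u) (F u) <= C) ->
  exists H : Om -> R, [/\ forall x, 0 <= H x, measurable_fun setT H,
    (\int[mu]_x (H x)%:E <= N%:R%:E)%E &
    {ae mu, forall x, forall u, S u -> F u x ^+ 2 <= C * H x}].
Proof.
move=> sF FL FC; have [[u0 Su0]|S0] := pselect (exists u, S u); last first.
  exists (fun=> 0); split => //.
  - by rewrite integral_cst// mul0e lee_fin.
  - by apply: aeW => x u Su; case: S0; exists u.
(* The members themselves, rather than the factors of the separable kernel,
   are used as generators: the factors need not be square integrable. *)
have [ts [tsN tsS tsF]] := separable_selection S sF.
have [H [H0 mH HN HF]] := @christoffel_bound _ _ _ mu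
  (fun i => F (nth u0 ts i)) (size ts) (fun i im => FL _ (tsS i u0 im)).
exists H; split => //.
  by apply: le_trans HN _; rewrite lee_fin ler_nat.
move: HF; apply: filterS => x HF u Su.
have [c cE] := tsF u Su.
have {}cE y : F u y = \sum_(i < size ts) c i * F (nth u0 ts i) y.
  by rewrite cE; apply: eq_bigr => i _; rewrite (set_nth_default u0).
have := HF c; rewrite -cE => /le_trans; apply.
rewrite ler_wpM2r//; apply: le_trans (FC u Su).
by rewrite le_eqVlt; apply/orP; left; apply/eqP; congr ip;
  apply/funext => y; rewrite cE.
Qed.

(** * Moments of a random vector along simple functions *)

Lemma weighted_young (R : realType) (a b A B q : R) :
  0 <= a -> 0 <= b -> 0 < A -> 0 < B -> 0 < q -> q <= 1 ->
  a `^ q * b `^ (1 - q) <=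
    A `^ q * B `^ (1 - q) * (q * A^-1 * a + (1 - q) * B^-1 * b).
Proof.
move=> a0 b0 A0 B0 q0 q1.
have aE : a `^ q = A `^ q * (a / A) `^ q.
  by rewrite -powRM ?divr_ge0 ?(ltW A0) ?(ltW B0)// mulrC divfK ?gt_eqF.
have bE : b `^ (1 - q) = B `^ (1 - q) * (b / B) `^ (1 - q).
  by rewrite -powRM ?divr_ge0 ?(ltW A0) ?(ltW B0)// mulrC divfK ?gt_eqF.
rewrite aE bE mulrACA ler_wpM2l ?mulr_ge0 ?powR_ge0//.
have [->|qn1] := eqVneq q 1.
  rewrite subrr powRr0 powRr1 ?divr_ge0 ?(ltW A0) ?(ltW B0)//.
  by rewrite !mul0r addr0 mulr1 mul1r mulrC.
have {}q1 : 0 < 1 - q by rewrite subr_gt0 lt_neqAle qn1.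
have := @conjugate_powR _ ((a / A) `^ q) ((b / B) `^ (1 - q)) q^-1 (1 - q)^-1.
rewrite !powR_ge0 !invr_gt0 !invrK => H.
apply: le_trans (H _ _ _ _ _) _ => //; first by ring.
rewrite -!powRrM !mulfV ?gt_eqF// !powRr1 ?divr_ge0 ?(ltW A0) ?(ltW B0)//.
by rewrite le_eqVlt; apply/orP; left; apply/eqP; ring.
Qed.

Lemma sqr_integrable_Lfun2 d (Om : measurableType d) (R : realType)
    (mu : {measure set Om -> \bar R}) (f : Om -> R) :
  measurable_fun setT f -> (\int[mu]_x (f x ^+ 2)%:E < +oo)%E ->
  f \in Lfun mu 2%:E.
Proof.
move=> mf f2; rewrite inE; apply/andP; split; first by rewrite inE.
rewrite inE /= /finite_norm unlock /=; apply: poweR_lty.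
apply: le_lt_trans f2; rewrite le_eqVlt; apply/orP; left; apply/eqP.
apply: eq_integral => x _; rewrite /= -[2]/(2%:R) powR_mulrn//.
by rewrite -normrX ger0_norm ?sqr_ge0.
Qed.

Lemma measurable_dotp (R : realType) (n : nat) d (Om : measurableType d)
    (X : {mfun Om >-> borel_rV R n}) (t : 'rV[R]_n) :
  measurable_fun setT (fun w => dotp t (X w)).
Proof.
apply: measurable_sum => i; apply: measurable_funM; first exact: measurable_cst.
apply: (measurability _ (RGenOpens.measurableE R)).
move=> _ [_ [a [b ->] <-]]; rewrite setTI.
rewrite (_ : _ @^-1` _ = X @^-1`
  ((fun x : 'rV[R]_n => x ord0 i) @^-1` `]a, b[%classic))//.
apply: measurable_funPTI; apply: sub_sigma_algebra.
have /continuousP := @coord_continuous R 1 n ord0 i.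
by apply; exact: interval_open.
Qed.

(** Hoelder's inequality with exponents [1 / q] and [1 / (1 - q)], the endpoint
    [q = 1] included. *)
Lemma integral_weighted_product_le d (Om : measurableType d) (R : realType)
    (mu : {measure set Om -> \bar R}) (a b : Om -> R) (A B q : R) :
  measurable_fun setT a -> measurable_fun setT b ->
  (forall x, 0 <= a x) -> (forall x, 0 <= b x) ->
  0 < A -> 0 < B -> 0 < q -> q <= 1 ->
  (\int[mu]_x (a x)%:E <= A%:E)%E -> (\int[mu]_x (b x)%:E <= B%:E)%E ->
  (\int[mu]_x (a x `^ q * b x `^ (1 - q))%:E <= (A `^ q * B `^ (1 - q))%:E)%E.
Proof.
move=> ma mb a0 b0 A0 B0 q0 q1 aA bB.
have q1' : 0 <= 1 - q by rewrite subr_ge0.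
set K := A `^ q * B `^ (1 - q).
have K0 : 0 <= K by rewrite mulr_ge0 ?powR_ge0.
pose ca := K * (q * A^-1); pose cb := K * ((1 - q) * B^-1).
have ca0 : 0 <= ca.
  by apply: mulr_ge0 => //; apply: mulr_ge0 => //; rewrite ?invr_ge0 ltW.
have cb0 : 0 <= cb.
  by apply: mulr_ge0 => //; apply: mulr_ge0 => //; rewrite ?invr_ge0 ltW.
have mEa : measurable_fun setT (fun x => (a x)%:E) by exact/measurable_EFinP.
have mEb : measurable_fun setT (fun x => (b x)%:E) by exact/measurable_EFinP.
apply: (@le_trans _ _ (\int[mu]_x (ca%:E * (a x)%:E + cb%:E * (b x)%:E))%E).
  apply: ge0_le_integral => //.
  - by move=> x _; rewrite lee_fin mulr_ge0 ?powR_ge0.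
  - apply/measurable_EFinP; apply: measurable_funM.
      exact: (measurableT_comp (measurable_powR _) ma).
    exact: (measurableT_comp (measurable_powR _) mb).
  - by apply: emeasurable_funD; exact: measurable_funeM.
  - move=> x _; rewrite -!EFinM -EFinD lee_fin.
    apply: le_trans (weighted_young _ _ A0 B0 q0 q1) _ => //.
    by rewrite -/K le_eqVlt; apply/orP; left; apply/eqP; rewrite /ca /cb; ring.
rewrite ge0_integralD//; last 4 first.
- by move=> x _; rewrite -EFinM lee_fin mulr_ge0.
- exact: measurable_funeM.
- by move=> x _; rewrite -EFinM lee_fin mulr_ge0.
- exact: measurable_funeM.
rewrite !ge0_integralZl_EFin//; last 2 first.
- by move=> x _; rewrite lee_fin.
- by move=> x _; rewrite lee_fin.
apply: (@le_trans _ _ (ca%:E * A%:E + cb%:E * B%:E)%E).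
  by apply: leeD; apply: lee_wpmul2l; rewrite ?lee_fin.
rewrite -!EFinM -EFinD lee_fin le_eqVlt; apply/orP; left; apply/eqP.
by rewrite /ca /cb; field; rewrite !gt_eqF.
Qed.

Section random_vector.
Import HBNNSimple.
Context (R : realType) (n : nat) d (Om : measurableType d).
Variables (P : probability Om R) (X : {RV P >-> borel_rV R n}).

Lemma nnsfun_integrable (h : {nnsfun Om >-> R}) :
  P.-integrable setT (EFin \o h).
Proof.
apply: measurable_bounded_integrable => //.
- by rewrite (le_lt_trans (probability_le1 _ _))// ltry.
- exact: simple_bounded.
Qed.

Lemma measurable_moment (t : 'rV[R]_n) (p : R) :
  measurable_fun setT (fun w => `|dotp t (X w)| `^ p).
Proof.
apply: (measurableT_comp (measurable_powR _)).
exact: (measurableT_comp _ (measurable_dotp X t)).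
Qed.

(** The key estimate. The expectation of [h], which appears on both sides of the
    inequality, is finite because [h] is simple, and can be divided out; neither
    the measurability nor the finiteness of the supremum is used. *)
Lemma nnsfun_strong_moment (T : set 'rV[R]_n) (k : nat) (p A : R)
    (h : {nnsfun Om >-> R}) :
  (0 < k)%N -> 2 * k%:R <= p -> 0 < A ->
  (forall t, T t -> (\int[P]_w (`|dotp t (X w)| `^ p)%:E <= A%:E)%E) ->
  (forall w,
    ((h w)%:E <= ereal_sup [set (`|dotp t (X w)| `^ p)%:E | t in T])%E) ->
  (\int[P]_w (h w)%:E <=
    ('C(n + k - 1, k)%:R `^ (p / (2 * k%:R)) * A)%:E)%E.
Proof.
move=> k0 kp A0 TA hT.
have k20 : 0 < 2 * k%:R :> R by rewrite mulr_gt0 ?ltr0n.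
have p0 : 0 < p by exact: lt_le_trans kp.
set N := 'C(n + k - 1, k).
have Bfin := integrable_fin_num measurableT (nnsfun_integrable h).
rewrite /= in Bfin.
have [B0|B0] := eqVneq (\int[P]_w (h w)%:E)%E 0%E.
  by rewrite B0 lee_fin mulr_ge0 ?powR_ge0 ?ltW.
have h0 w : 0 <= h w by [].
pose B := fine (\int[P]_w (h w)%:E)%E.
have BE : B%:E = (\int[P]_w (h w)%:E)%E by rewrite fineK.
have {}B0 : 0 < B.
  rewrite -lte_fin BE lt_neqAle eq_sym B0 /=.
  by apply: integral_ge0 => w _; rewrite lee_fin.
pose q := 2 * k%:R / p.
have q0 : 0 < q by rewrite divr_gt0.
have q1 : q <= 1 by rewrite ler_pdivrMr// mul1r.
have mh : measurable_fun setT h by [].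
pose C := A `^ q * B `^ (1 - q).
have C0 : 0 <= C by rewrite mulr_ge0 ?powR_ge0.
(* The square of [F t] is [|<t,X>|^(2 k) * h^(1 - q)]. *)
pose F (t : 'rV[R]_n) w := dotp t (X w) ^+ k * h w `^ ((1 - q) / 2).
have FE t w : F t w ^+ 2 = (`|dotp t (X w)| `^ p) `^ q * h w `^ (1 - q).
  rewrite /F exprMn -powRrM (_ : p * q = (2 * k)%:R); last first.
    by rewrite natrM /q; field; rewrite gt_eqF.
  rewrite powR_mulrn// mulnC exprM; congr (_ * _).
    by rewrite -normrX real_normK ?num_real.
  by rewrite -powR_mulrn ?powR_ge0// -powRrM divfK.
have mF t : measurable_fun setT (F t).
  apply: measurable_funM; first exact/measurable_funX/measurable_dotp.
  exact: (measurableT_comp (measurable_powR _) mh).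
have FC t : T t -> (\int[P]_w (F t w ^+ 2)%:E <= C%:E)%E.
  move=> Tt; under eq_integral => w _ do rewrite FE.
  apply: integral_weighted_product_le => //; first exact: measurable_moment.
  - exact: TA.
  - by rewrite BE.
have FL t : T t -> F t \in Lfun P 2%:E.
  move=> Tt; apply: sqr_integrable_Lfun2 => //.
  by rewrite (le_lt_trans (FC t Tt))// ltry.
have sF : separable N F.
  have := separable_exp_sum R (enum 'I_n) k.
  rewrite size_enum_ord => -[a [b ab]].
  exists (fun j t => a j (t ord0)).
  exists (fun j w => b j (X w ord0) * h w `^ ((1 - q) / 2)) => t w.
  under eq_bigr => j _ do rewrite mulrA.
  rewrite -mulr_suml -ab /F; congr (_ ^+ _ * _).
  by rewrite /dotp big_enum.
have [|H [H0 mH HN HF]] := separable_ae_bound (C := C) sF FL.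
  move=> t Tt; rewrite -lee_fin EFin_ip ?FL//; apply: le_trans (FC t Tt).
  by under eq_integral => w _ do rewrite -expr2.
(* Taking the supremum over [t] in [F t w ^ 2 <= C * H w] bounds [h] itself. *)
have hH : {ae P, forall w, h w <= C * H w}.
  move: HF; apply: filterS => w HF.
  have := h0 w; rewrite le_eqVlt => /predU1P[<-|hw]; first by rewrite mulr_ge0.
  have hw' : 0 < h w `^ (1 - q) by rewrite powR_gt0.
  pose M := C * H w / h w `^ (1 - q).
  have M0 : 0 <= M by rewrite divr_ge0 ?mulr_ge0 ?powR_ge0.
  have hM : h w <= M `^ q^-1.
    rewrite -lee_fin; apply: le_trans (hT w) _.
    apply: ge_ereal_sup => _ /= [t Tt <-]; rewrite lee_fin.
    rewrite -(@powRr1 _ (_ `^ p)) ?powR_ge0// -(@mulfV _ q) ?gt_eqF// powRrM.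
    apply: ge0_ler_powR; rewrite ?nnegrE ?invr_ge0 ?powR_ge0 ?(ltW q0)//.
    by rewrite /M ler_pdivlMr// -FE HF.
  have hM' : h w `^ q <= M.
    have := ge0_ler_powR (ltW q0) (h0 w) (powR_ge0 _ _) hM.
    by rewrite -powRrM mulVf ?gt_eqF// powRr1.
  have -> : h w = h w `^ q * h w `^ (1 - q).
    rewrite -powRD; first by rewrite addrC subrK powRr1.
    by apply/implyP => _; rewrite gt_eqF.
  by rewrite -ler_pdivlMr.
have BN : B <= C * N%:R.
  rewrite -lee_fin BE.
  apply: (@le_trans _ _ (\int[P]_w (C%:E * (H w)%:E))%E).
    apply: ae_ge0_le_integral => //.
    - by move=> w _; rewrite lee_fin.
    - exact/measurable_EFinP.
    - by move=> w _; rewrite -EFinM lee_fin mulr_ge0.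
    - by apply: measurable_funeM; exact/measurable_EFinP.
    - by move: hH; apply: filterS => w ? _; rewrite -EFinM lee_fin.
  rewrite ge0_integralZl_EFin//; last 2 first.
  - by move=> w _; rewrite lee_fin.
  - exact/measurable_EFinP.
  rewrite [leRHS]EFinM; apply: lee_wpmul2l; last exact: HN.
  by rewrite lee_fin.
have BB : 0 < B `^ (1 - q) by rewrite powR_gt0.
(* Here [C = A ^ q * B ^ (1 - q)], and [B > 0] is divided out. *)
have Bq : B `^ q <= A `^ q * N%:R.
  rewrite -(ler_pM2r BB) -powRD; last by apply/implyP => _; rewrite gt_eqF.
  by rewrite addrC subrK powRr1 ?(ltW B0)//; apply: le_trans BN _; rewrite /C mulrAC.
rewrite -BE lee_fin.
have qi0 : 0 <= q^-1 by rewrite invr_ge0 ltW.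
have := ge0_ler_powR qi0 (powR_ge0 _ _ : _ \is Num.nneg) _ Bq.
rewrite nnegrE mulr_ge0 ?powR_ge0// => /(_ isT).
rewrite powRM ?powR_ge0// -!powRrM mulfV ?gt_eqF// !powRr1 ?(ltW A0) ?(ltW B0)//.
by rewrite mulrC /q invf_div.
Qed.

End random_vector.

(** * A bound on binomial coefficients *)

Lemma exprn_le_factorial_expR (R : realType) (k : nat) :
  k%:R ^+ k <= expR k%:R * (k`!)%:R :> R.
Proof.
elim: k => [|k IHk]; first by rewrite expr0 expR0 fact0 mulr1.
have [->|k0] := posnP k.
  by rewrite expr1n mulr1 (le_trans _ (expR_ge1Dx 1))// lerDr.
have k0' : 0 < k%:R :> R by rewrite ltr0n.
rewrite factS natrM mulrCA exprS -natr1 ler_wpM2l ?addr_ge0//.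
(* This is [(1 + 1 / k) ^ k <= e], cleared of denominators. *)
have step : (k%:R + 1) ^+ k <= expR 1 * k%:R ^+ k :> R.
  have -> : k%:R + 1 = (1 + k%:R^-1) * k%:R :> R by field; rewrite gt_eqF.
  rewrite exprMn ler_wpM2r ?exprn_ge0//.
  have -> : expR 1 = expR k%:R^-1 ^+ k :> R.
    by rewrite -expRM_natl mulfV ?gt_eqF.
  by apply: lerXn2r; rewrite ?nnegrE ?addr_ge0 ?expR_ge0 ?expR_ge1Dx ?invr_ge0.
rewrite (le_trans step)// expRD (mulrC (expR k%:R)) -mulrA.
by rewrite ler_wpM2l ?expR_ge0.
Qed.

(** From ['C(m, k) <= m ^ k / k!] and [k! >= (k / e) ^ k]. *)
Lemma bin_le_expR (R : realType) (m k : nat) :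
  (0 < k)%N -> 'C(m, k)%:R <= (expR 1 * m%:R / k%:R) ^+ k :> R.
Proof.
move=> k0; have k0' : 0 < k%:R ^+ k :> R by rewrite exprn_gt0 ?ltr0n.
rewrite exprMn exprVn ler_pdivlMr// exprMn.
have : ('C(m, k) * k`! <= m ^ k)%N.
  rewrite bin_ffact ffact_prod -[in leqRHS](card_ord k) -prod_nat_const.
  by apply: leq_prod => i _; rewrite leq_subr.
rewrite -(ler_nat R) natrM natrX => H.
apply: le_trans (_ : 'C(m, k)%:R * (expR k%:R * (k`!)%:R) <= _).
  by rewrite ler_wpM2l// exprn_le_factorial_expR.
have -> : expR 1 ^+ k = expR k%:R :> R by rewrite -expRM_natl mulr1.
by rewrite mulrCA ler_wpM2l ?expR_ge0.
Qed.

(** * Norms and their dual balls *)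

Lemma is_norm0 (R : realType) (n : nat) (N : 'rV[R]_n -> R) :
  is_norm N -> N 0 = 0.
Proof.
by move=> hN; rewrite -(scale0r 0) is_norm_homogeneous// normr0 mul0r.
Qed.

Lemma is_norm_ge0 (R : realType) (n : nat) (N : 'rV[R]_n -> R)
    (hN : is_norm N) (x : 'rV[R]_n) : 0 <= N x.
Proof.
have := is_norm_triangle hN x (- x).
rewrite subrr is_norm0// -scaleN1r is_norm_homogeneous// normrN1 mul1r; lra.
Qed.

(** Hahn-Banach for finitely many vectors. A functional on the span of
    [v 0, ..., v m] is given by its values [c i] at the [v i]; the domination
    by [N] makes it well defined, so that no linear independence is needed. *)
Lemma norm_dominated_extension (R : realType) (n : nat) (N : 'rV[R]_n -> R)
    (hN : is_norm N) (v : nat -> 'rV[R]_n) (m : nat) :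
  exists c : nat -> R, c 0%N = N (v 0%N) /\
    forall a : nat -> R,
      \sum_(i < m.+1) a i * c i <= N (\sum_(i < m.+1) a i *: v i).
Proof.
elim: m => [|m [c [c0 cN]]].
  exists (fun _ => N (v 0%N)); split=> // a.
  by rewrite !big_ord1 is_norm_homogeneous// ler_wpM2r ?is_norm_ge0// ler_norm.
pose L (a : nat -> R) := \sum_(i < m.+1) a i * c i.
pose V (a : nat -> R) := \sum_(i < m.+1) a i *: v i.
pose w := v m.+1.
have LD a b : L (a \+ b) = L a + L b.
  by rewrite /L -big_split /=; apply: eq_bigr => i _; rewrite mulrDl.
have VD a b : V (a \+ b) = V a + V b.
  by rewrite /V -big_split /=; apply: eq_bigr => i _; rewrite scalerDl.
have LZ k a : L (k \*o a) = k * L a.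
  by rewrite /L mulr_sumr; apply: eq_bigr => i _; rewrite /= mulrA.
have VZ k a : V (k \*o a) = k *: V a.
  by rewrite /V scaler_sumr; apply: eq_bigr => i _; rewrite /= scalerA.
have key a b : L a - N (V a - w) <= N (V b + w) - L b.
  have := is_norm_triangle hN (V a - w) (V b + w).
  have := cN (a \+ b); rewrite -/(L _) -/(V _) LD VD.
  have -> : V a - w + (V b + w) = V a + V b by rewrite addrACA addNr addr0.
  lra.
(* The value at [v m.+1] can be any number that separates the two sides of
   [key]; [sup S] is chosen. *)
pose S := [set L a - N (V a - w) | a in setT].
have S0 : S !=set0 by exists (L (cst 0) - N (V (cst 0) - w)); exists (cst 0).
have Sub b : ubound S (N (V b + w) - L b) by move=> _ [a _ <-].
pose k := sup S.
have kl a : L a - N (V a - w) <= k.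
  apply: sup_upper_bound; last by exists a.
  by split=> //; exists (N (V (cst 0) + w) - L (cst 0)).
have ku b : k <= N (V b + w) - L b by apply: ge_sup.
exists (fun i => if i == m.+1 then k else c i); split=> // a.
rewrite big_ord_recr [in leRHS]big_ord_recr /= eqxx.
rewrite (eq_bigr (fun i : 'I_m.+1 => a i * c i)); last first.
  by move=> i _; rewrite ltn_eqF// ltn_ord.
rewrite -/(L a) -/(V a) -/w.
have [a0|a0|->] := ltgtP (a m.+1) 0.
- have a1 : a m.+1 != 0 by rewrite lt_eqF.
  have := kl ((- a m.+1)^-1 \*o a); rewrite LZ VZ.
  have -> : (- a m.+1)^-1 *: V a - w = (- a m.+1)^-1 *: (V a + a m.+1 *: w).
    by rewrite scalerDr scalerA invrN mulNr mulVf// scaleN1r.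
  rewrite is_norm_homogeneous// ger0_norm; last by rewrite invr_ge0; lra.
  rewrite -mulrBr mulrC ler_pdivrMr; last lra.
  by nra.
- have a1 : a m.+1 != 0 by rewrite gt_eqF.
  have := ku ((a m.+1)^-1 \*o a); rewrite LZ VZ.
  have -> : (a m.+1)^-1 *: V a + w = (a m.+1)^-1 *: (V a + a m.+1 *: w).
    by rewrite scalerDr scalerA mulVf// scale1r.
  rewrite is_norm_homogeneous// ger0_norm; last by rewrite invr_ge0; lra.
  rewrite -mulrBr mulrC ler_pdivlMr//.
  by nra.
- by rewrite mul0r scale0r !addr0; exact: cN.
Qed.

Lemma dotpZr (R : realType) (n : nat) (a : R) (t x : 'rV[R]_n) :
  dotp t (a *: x) = a * dotp t x.
Proof. by rewrite /dotp mulr_sumr; apply: eq_bigr => i _; rewrite mxE mulrCA. Qed.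

(** Every norm is the supremum of the functionals in its dual ball. *)
Lemma norm_attained_dual_ball (R : realType) (n : nat) (N : 'rV[R]_n -> R)
    (hN : is_norm N) (x : 'rV[R]_n) :
  exists2 t : 'rV[R]_n, (dual_norm N t <= 1)%E & N x <= dotp t x.
Proof.
have N0 := is_norm0 hN.
(* The functional is extended along [x], then the canonical basis; the
   default value 0 is never used. *)
pose v (i : nat) : 'rV[R]_n := if i is j.+1 then
  if insub j is Some j' then delta_mx ord0 (j' : 'I_n) else 0 else x.
have [c [c0 cN]] := norm_dominated_extension hN v n.
pose t : 'rV[R]_n := \row_(i < n) c i.+1.
have vE (a : nat -> R) : \sum_(i < n.+1) a i *: v i
    = a 0%N *: x + \sum_(i < n) a i.+1 *: delta_mx ord0 i.
  rewrite big_ord_recl; congr (_ + _); apply: eq_bigr => i _.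
  rewrite lift0 /v; case: insubP => [j _ ji|]; last by rewrite ltn_ord.
  by congr (_ *: delta_mx _ _); apply: val_inj.
have cE (a : nat -> R) : \sum_(i < n.+1) a i * c i
    = a 0%N * N x + \sum_(i < n) a i.+1 * c i.+1.
  by rewrite big_ord_recl /= c0.
(* Coefficients of [b *: x + y] on the vectors [v i]. *)
pose co (b : R) (y : 'rV[R]_n) (i : nat) :=
  if i is j.+1 then if insub j is Some j' then y ord0 (j' : 'I_n) else 0 else b.
have coE b y (i : 'I_n) : co b y i.+1 = y ord0 i.
  rewrite /co; case: insubP => [j _ ji|]; last by rewrite ltn_ord.
  by congr (y _ _); apply: val_inj.
have dom b y : b * N x + dotp t y <= N (b *: x + y).
  have := cN (co b y); rewrite vE cE /=.
  have -> : \sum_(i < n) co b y i.+1 * c i.+1 = dotp t y.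
    by apply: eq_bigr => i _; rewrite coE mxE mulrC.
  suff -> : \sum_(i < n) co b y i.+1 *: delta_mx ord0 i = y by [].
  by rewrite [RHS]row_sum_delta; apply: eq_bigr => i _; rewrite coE.
(* The choice [b = 1], [y = - x] gives the lower bound, [b = 0] the dual norm. *)
exists t; last first.
  have := dom 1 (- x); rewrite scale1r subrr N0 -scaleN1r dotpZr; lra.
apply: ge_ereal_sup => _ /= [y Ny <-]; rewrite lee_fin ler_norml.
have := dom 0 y; have := dom 0 (- y).
rewrite scale0r !add0r mul0r !add0r -scaleN1r dotpZr is_norm_homogeneous//.
by rewrite normrN1; lra.
Qed.

(** * Comparison of weak and strong moments *)

(** The constant of the comparison between weak and strong moments. *)
Definition moment_constant (R : realType) (n : nat) (p : R) : R :=
  2 * Num.sqrt (expR 1) * Num.sqrt ((n%:R + p) / p).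

(** The factor 2 in the constant absorbs the rounding of [p / 2] down to an
    integer [k >= 1], for which [p < 2 * k + 2 <= 4 * k]. *)
Lemma bin_le_moment_constant (R : realType) (n k : nat) (p : R) :
  (0 < k)%N -> 0 < p -> p <= 4 * k%:R ->
  'C(n + k - 1, k)%:R <= moment_constant n p ^+ (2 * k).
Proof.
move=> k0 p0 pk; have kR : 0 < k%:R :> R by rewrite ltr0n.
apply: le_trans (bin_le_expR R _ k0) _.
have np0 : 0 <= (n%:R + p) / p by rewrite divr_ge0 ?addr_ge0 ?(ltW p0).
rewrite exprM; apply: lerXn2r.
- by rewrite nnegrE divr_ge0 ?mulr_ge0 ?expR_ge0.
- by rewrite nnegrE sqr_ge0.
rewrite /moment_constant !exprMn !sqr_sqrtr ?expR_ge0//.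
rewrite -mulrA (mulrC (2 ^+ 2)) -mulrA ler_wpM2l ?expR_ge0//.
rewrite ler_pdivrMr//.
rewrite (_ : _ * k%:R = 4 * (n%:R + p) * k%:R / p); last first.
  by field; rewrite gt_eqF.
rewrite ler_pdivlMr//.
have nk : (n + k - 1)%:R <= n%:R + k%:R :> R by rewrite -natrD ler_nat leq_subr.
have n0 : 0 <= n%:R :> R by [].
apply: (@le_trans _ _ ((n%:R + k%:R) * p)); first by rewrite ler_wpM2r ?(ltW p0).
by nra.
Qed.

Section weak_strong.
Context (R : realType) (n : nat) d (Om : measurableType d).
Variables (P : probability Om R) (X : {RV P >-> borel_rV R n}) (p : R).
Hypothesis p2 : 2 <= p.
Variables (T : set 'rV[R]_n) (g : Om -> \bar R).
Hypothesis g0 : forall w, (0 <= g w)%E.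
Hypothesis gT : forall w,
  (g w <= ereal_sup [set (`|dotp t (X w)| `^ p)%:E | t in T])%E.

Let p0 : 0 < p. Proof. by apply: lt_le_trans p2. Qed.

(** The functions [g] below the supremum are not assumed measurable: the
    integral of a nonnegative function is the supremum of the integrals of the
    simple functions below it. *)
Lemma strong_moment_le_fin (s : R) : 0 < s ->
  (forall t, T t -> ((\int[P]_w (`|dotp t (X w)| `^ p)%:E) `^ p^-1 <= s%:E)%E) ->
  ((\int[P]_w g w) `^ p^-1 <= (moment_constant n p * s)%:E)%E.
Proof.
move=> s0 Ts.
pose k := Num.truncn (p / 2).
have p20 : 0 <= p / 2 by rewrite divr_ge0 ?ltW.
have /andP[kp pk] := truncn_itv p20.
rewrite -/k in kp pk.
have k0 : (0 < k)%N.
  rewrite lt0n; apply/eqP => k0; move: pk; rewrite k0 => pk.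
  by have := p2; lra.
have k1 : 1 <= k%:R :> R by rewrite ler1n.
have kp' : 2 * k%:R <= p by lra.
have pk' : p <= 4 * k%:R by move: pk; rewrite -[k.+1%:R]natr1; lra.
have K0 : 0 <= moment_constant n p by apply: mulr_ge0; rewrite ?mulr_ge0 ?sqrtr_ge0.
have powK x : 0 <= x -> (x `^ p) `^ p^-1 = x.
  by move=> x0; rewrite -powRrM mulfV ?gt_eqF// powRr1.
have TA t : T t -> (\int[P]_w (`|dotp t (X w)| `^ p)%:E <= (s `^ p)%:E)%E.
  move=> Tt; set I := (\int[P]_w _)%E.
  have I0 : (0 <= I)%E by apply: integral_ge0 => w _; rewrite lee_fin powR_ge0.
  have := gt0_ler_poweR (ltW p0) _ _ (Ts t Tt).
  rewrite -/I -poweRrM mulVf ?gt_eqF// poweRe1// poweR_EFin; apply.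
    by rewrite in_itv /= leey poweR_ge0.
  by rewrite in_itv /= leey lee_fin ltW.
have gA : (\int[P]_w g w <= ((moment_constant n p * s) `^ p)%:E)%E.
  rewrite ge0_integralTE//; apply: ge_ereal_sup => _ /= [h hg <-].
  rewrite -integralT_nnsfun.
  apply: (le_trans (nnsfun_strong_moment k0 kp' (powR_gt0 p s0) TA _)).
    by move=> w; exact: le_trans (hg w) (gT w).
  rewrite lee_fin powRM ?(ltW s0)// ler_wpM2r ?powR_ge0//.
  have -> : moment_constant n p `^ p =
      (moment_constant n p ^+ (2 * k)) `^ (p / (2 * k%:R)).
    rewrite -powR_mulrn// -powRrM natrM mulrC divfK//.
    by rewrite mulf_neq0// gt_eqF// ltr0n.
  apply: ge0_ler_powR; rewrite ?nnegrE ?exprn_ge0//.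
    by rewrite divr_ge0 ?(ltW p0)// mulr_ge0.
  exact: bin_le_moment_constant.
have pi0 : 0 <= p^-1 by rewrite invr_ge0 ltW.
apply: le_trans (gt0_ler_poweR pi0 _ _ gA) _.
- by rewrite in_itv /= leey integral_ge0.
- by rewrite in_itv /= leey lee_fin powR_ge0.
by rewrite poweR_EFin powK// mulr_ge0// ltW.
Qed.

Lemma strong_moment_le : T !=set0 ->
  ((\int[P]_w g w) `^ p^-1 <= (moment_constant n p)%:E *
    ereal_sup [set 'E_P[fun w => (`|dotp t (X w)| `^ p)%R] `^ p^-1 | t in T])%E.
Proof.
move=> [t0 Tt0]; set S := ereal_sup _.
have TS t : T t -> ((\int[P]_w (`|dotp t (X w)| `^ p)%:E) `^ p^-1 <= S)%E.
  by move=> Tt; apply: ereal_sup_ubound; exists t; rewrite ?unlock.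
have K0 : 0 < moment_constant n p.
  apply: mulr_gt0; first by rewrite mulr_gt0 ?sqrtr_gt0 ?expR_gt0.
  rewrite sqrtr_gt0 divr_gt0//.
  by rewrite ltr_wpDl.
have S0 : (0 <= S)%E by apply: le_trans (TS _ Tt0); exact: poweR_ge0.
case: S S0 TS => [s s0 TS|_ _|//]; last by rewrite gt0_muley ?lte_fin// leey.
rewrite lee_fin in s0.
apply/lee_addgt0Pr => e e0.
(* The previous lemma needs a positive bound, hence the perturbation of [s]. *)
pose eK := e / moment_constant n p.
have eK0 : 0 < eK by rewrite divr_gt0.
apply: le_trans (@strong_moment_le_fin (s + eK) _ _) _.
- by rewrite ltr_wpDl.
- by move=> t Tt; apply: le_trans (TS t Tt) _; rewrite lee_fin lerDl ltW.
by rewrite -EFinM -EFinD lee_fin mulrDr lerD2l /eK mulrC divfK ?gt_eqF.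
Qed.

End weak_strong.

Theorem theorem1 (R : realType) (n : nat) (hn : (1 <= n)%N)
    (d : measure_display) (Omega : measurableType d) (P : probability Omega R)
    (X : {RV P >-> borel_rV R n}) (p : R) (hp : 2 <= p) :
  (forall T : set 'rV[R]_n, T !=set0 ->
    ((\int[P]_w ereal_sup [set (`|dotp t (X w)| `^ p)%R%:E | t in T]) `^ p^-1
     <= (2 * Num.sqrt (expR 1) * Num.sqrt ((n%:R + p) / p))%R%:E *
        ereal_sup [set 'E_P[fun w => (`|dotp t (X w)| `^ p)%R] `^ p^-1 | t in T])%E)
  /\
  (forall N : 'rV[R]_n -> R, is_norm N ->
    ('E_P[fun w => (N (X w) `^ p)%R] `^ p^-1
     <= (2 * Num.sqrt (expR 1) * Num.sqrt ((n%:R + p) / p))%R%:E *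
        ereal_sup [set 'E_P[fun w => (`|dotp t (X w)| `^ p)%R] `^ p^-1
                  | t in [set t | (dual_norm N t <= 1)%E]])%E).
Proof.
split=> [T T0|N hN].
  apply: strong_moment_le => // w; have [t Tt] := T0.
  apply: le_trans (_ : (`|dotp t (X w)| `^ p)%:E <= _)%E.
    by rewrite lee_fin powR_ge0.
  by apply: ereal_sup_ubound; exists t.
rewrite [in leLHS]unlock; apply: strong_moment_le => //.
- by move=> w; rewrite lee_fin powR_ge0.
- move=> w; have [t Nt Nx] := norm_attained_dual_ball hN (X w).
  apply: le_trans (_ : (`|dotp t (X w)| `^ p)%:E <= _)%E; last first.
    by apply: ereal_sup_ubound; exists t.
  have N0 := is_norm_ge0 hN (X w).
  rewrite lee_fin; apply: ge0_ler_powR; rewrite ?nnegrE//.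
    by apply: le_trans hp.
  exact: le_trans Nx (ler_norm _).
- by have [t Nt _] := norm_attained_dual_ball hN 0; exists t.
Qed.
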